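(* Let $\mathcal{C}$ be a (spherical) fusion category and $\mathcal{D}\subset\mathcal{C}$ an integral fusion subcategory with $\mathrm{rank}(\mathcal{D})+2=\mathrm{rank}(\mathcal{C})$. Denote the elements of $\mathcal{O}(\mathcal{C})\setminus\mathcal{O}(\mathcal{D})$ by $\rho_1,\rho_2$. If there exists $X\in\mathcal{O}(\mathcal{D})$ such that $N_{X,\rho_1}^{\rho_2}$ or $N_{X,\rho_2}^{\rho_1}$ is nonzero, then $\dim(\rho_1)$ and $\dim(\rho_2)$ are quadratic integers (possibly rational).
   Context: Fusion categories are over $\mathbb{C}$; $\mathcal{O}(\mathcal{C})$ is the set of isomorphism classes of simple objects and $\mathrm{rank}(\mathcal{C})=|\mathcal{O}(\mathcal{C})|$. $N_{X,Y}^Z=\dim_{\mathbb{C}}\mathrm{Hom}_{\mathcal{C}}(Z,X\otimes Y)$ for simple $X,Y,Z$. $\mathcal{D}$ is integral if all its objects have integer Frobenius-Perron dimension. $\dim$ is the categorical dimension with respect to a spherical structure on $\mathcal{C}$. ''Quadratic integer (possibly rational)'' means an algebraic integer of degree at most $2$ over $\mathbb{Q}$. *)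

(* Defs.v *)
From HB Require Import structures.
From mathcomp Require Export all_boot all_order all_algebra.
From mathcomp Require Export boolp classical_sets cardinality reals.
From mathcomp Require Export complex.
From mathcomp Require Import finmap.

Set Implicit Arguments.
Unset Strict Implicit.
Unset Printing Implicit Defensive.

Import Order.TTheory GRing.Theory Num.Theory.
Local Open Scope classical_set_scope.
Local Open Scope ring_scope.

Reserved Notation "g \oc f" (at level 50, left associativity).
Reserved Notation "X \ox Y" (at level 40, left associativity).
Reserved Notation "f \om g" (at level 40, left associativity).

(* Categories are linear over an arbitrary field K, to be taken as R[i], the
   complex numbers, for R : realType. *)

(** * Linear and abelian categories *)

(* Hom spaces are finite-dimensional by being vectTypes; [comp g f] is "g after
   f". *)
Record linCategory (K : fieldType) := LinCategory {
  obj :> Type;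
  hom : obj -> obj -> vectType K;
  idm : forall X, hom X X;
  comp : forall X Y Z, hom Y Z -> hom X Y -> hom X Z;
  comp_idl : forall X Y (f : hom X Y), comp (idm Y) f = f;
  comp_idr : forall X Y (f : hom X Y), comp f (idm X) = f;
  comp_assoc : forall X Y Z W (h : hom Z W) (g : hom Y Z) (f : hom X Y),
    comp h (comp g f) = comp (comp h g) f;
  comp_linl : forall X Y Z (f : hom X Y) (c : K) (g g' : hom Y Z),
    comp (c *: g + g') f = c *: comp g f + comp g' f;
  comp_linr : forall X Y Z (g : hom Y Z) (c : K) (f f' : hom X Y),
    comp g (c *: f + f') = c *: comp g f + comp g f'
}.

Arguments hom {K C} X Y : rename.
Arguments idm {K C} X : rename.
Arguments comp {K C X Y Z} g f : rename.

Notation "g \oc f" := (comp g f) : ring_scope.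

Section Abelian.
Context {K : fieldType} {C : linCategory K}.
Implicit Types X Y Z : C.

Definition inverse_pair X Y (f : hom X Y) (g : hom Y X) : Prop :=
  g \oc f = idm X /\ f \oc g = idm Y.

Definition is_iso X Y (f : hom X Y) : Prop := exists g, inverse_pair f g.

Definition isomorphic X Y : Prop := exists f : hom X Y, is_iso f.

Definition is_mono X Y (f : hom X Y) : Prop :=
  forall Z (u v : hom Z X), f \oc u = f \oc v -> u = v.

Definition is_epi X Y (f : hom X Y) : Prop :=
  forall Z (u v : hom Y Z), u \oc f = v \oc f -> u = v.

Definition is_kernel X Y (f : hom X Y) U (k : hom U X) : Prop :=
  f \oc k = 0 /\
  forall Z (g : hom Z X), f \oc g = 0 -> exists! h : hom Z U, k \oc h = g.

Definition is_cokernel X Y (f : hom X Y) Q (q : hom Y Q) : Prop :=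
  q \oc f = 0 /\
  forall Z (g : hom Y Z), g \oc f = 0 -> exists! h : hom Q Z, h \oc q = g.

(* n = 0 says that X is a zero object. *)
Definition is_direct_sum X n (s : 'I_n -> C) : Prop :=
  exists (i_ : forall k, hom (s k) X) (p_ : forall k, hom X (s k)),
    [/\ forall k, p_ k \oc i_ k = idm (s k),
        forall k l, k != l -> p_ k \oc i_ l = 0
      & \sum_(k < n) (i_ k \oc p_ k) = idm X].

Definition is_zero_object X : Prop := idm X = 0.

Definition simple X : Prop :=
  ~ is_zero_object X /\
  forall U (u : hom U X), is_mono u -> is_zero_object U \/ is_iso u.

Definition iso_class X : set C := [set Y | isomorphic X Y].

(* O(D), for the full subcategory on a set D of objects closed under direct
   summands: then the simple objects of D are those of C that lie in D. *)
Definition simple_classes (D : set C) : set (set C) :=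
  [set iso_class X | X in [set X | simple X /\ D X]].

Definition rank (D : set C) : nat := #|` fset_set (simple_classes D) |%fset.

End Abelian.

Definition abelian_category K (C : linCategory K) : Prop :=
  [/\ forall n (s : 'I_n -> C), exists X, is_direct_sum X s,
      forall (X Y : C) (f : hom X Y), exists U (k : hom U X), is_kernel f k,
      forall (X Y : C) (f : hom X Y), exists Q (q : hom Y Q), is_cokernel f q,
      forall (X Y : C) (f : hom X Y), is_mono f ->
        exists Z (g : hom Y Z), is_kernel g f
    & forall (X Y : C) (f : hom X Y), is_epi f ->
        exists Z (g : hom Z X), is_cokernel g f].

Definition semisimple K (C : linCategory K) : Prop :=
  forall X : C, exists n (s : 'I_n -> C),
    (forall k, simple (s k)) /\ is_direct_sum X s.

(** * Monoidal categories and duals *)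

Record monCategory (K : fieldType) := MonCategory {
  mon_cat :> linCategory K;
  unit_ : mon_cat;
  tens : mon_cat -> mon_cat -> mon_cat;
  tensm : forall X X' Y Y' : mon_cat,
    hom X X' -> hom Y Y' -> hom (tens X Y) (tens X' Y');
  tensm_id : forall X Y : mon_cat, tensm (idm X) (idm Y) = idm (tens X Y);
  tensm_comp : forall (X X' X'' Y Y' Y'' : mon_cat)
      (f' : hom X' X'') (f : hom X X') (g' : hom Y' Y'') (g : hom Y Y'),
    tensm (f' \oc f) (g' \oc g) = tensm f' g' \oc tensm f g;
  tensm_linl : forall (X X' Y Y' : mon_cat) (c : K)
      (f f' : hom X X') (g : hom Y Y'),
    tensm (c *: f + f') g = c *: tensm f g + tensm f' g;
  tensm_linr : forall (X X' Y Y' : mon_cat) (c : K)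
      (f : hom X X') (g g' : hom Y Y'),
    tensm f (c *: g + g') = c *: tensm f g + tensm f g';
  assoc : forall X Y Z : mon_cat, hom (tens (tens X Y) Z) (tens X (tens Y Z));
  assocV : forall X Y Z : mon_cat, hom (tens X (tens Y Z)) (tens (tens X Y) Z);
  lunit : forall X : mon_cat, hom (tens unit_ X) X;
  lunitV : forall X : mon_cat, hom X (tens unit_ X);
  runit : forall X : mon_cat, hom (tens X unit_) X;
  runitV : forall X : mon_cat, hom X (tens X unit_);
  assocK : forall X Y Z : mon_cat, inverse_pair (assoc X Y Z) (assocV X Y Z);
  lunitK : forall X : mon_cat, inverse_pair (lunit X) (lunitV X);
  runitK : forall X : mon_cat, inverse_pair (runit X) (runitV X);
  assoc_nat : forall (X X' Y Y' Z Z' : mon_cat)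
      (f : hom X X') (g : hom Y Y') (h : hom Z Z'),
    assoc X' Y' Z' \oc tensm (tensm f g) h =
    tensm f (tensm g h) \oc assoc X Y Z;
  lunit_nat : forall (X Y : mon_cat) (f : hom X Y),
    lunit Y \oc tensm (idm unit_) f = f \oc lunit X;
  runit_nat : forall (X Y : mon_cat) (f : hom X Y),
    runit Y \oc tensm f (idm unit_) = f \oc runit X;
  pentagon : forall X Y Z W : mon_cat,
    assoc X Y (tens Z W) \oc assoc (tens X Y) Z W =
    tensm (idm X) (assoc Y Z W) \oc assoc X (tens Y Z) W
      \oc tensm (assoc X Y Z) (idm W);
  triangle : forall X Y : mon_cat,
    tensm (idm X) (lunit Y) \oc assoc X unit_ Y = tensm (runit X) (idm Y)
}.

Arguments unit_ {K C} : rename.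
Arguments tens {K C} X Y : rename.
Arguments tensm {K C X X' Y Y'} f g : rename.
Arguments assoc {K C} X Y Z : rename.
Arguments assocV {K C} X Y Z : rename.
Arguments lunit {K C} X : rename.
Arguments lunitV {K C} X : rename.
Arguments runit {K C} X : rename.
Arguments runitV {K C} X : rename.

Notation "X \ox Y" := (tens X Y) : ring_scope.
Notation "f \om g" := (tensm f g) : ring_scope.

(* (V, e, c) is a left dual of X (hence X is a right dual of V). *)
Definition is_left_dual K (C : monCategory K) (X V : C)
    (e : hom (V \ox X) unit_) (c : hom unit_ (X \ox V)) : Prop :=
  runit X \oc (idm X \om e) \oc assoc X V X \oc (c \om idm X) \oc lunitV X
    = idm X /\
  lunit V \oc (e \om idm V) \oc assocV V X V \oc (idm V \om c) \oc runitV V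
    = idm V.

(** * Fusion categories *)

(* The choice of left duals [dual] is part of the data (duals are unique up to
   unique isomorphism). *)
Record fusionCategory (K : fieldType) := FusionCategory {
  fus_cat :> monCategory K;
  fus_abelian : abelian_category fus_cat;
  fus_semisimple : semisimple fus_cat;
  fus_finite : finite_set (simple_classes [set: fus_cat]);
  fus_unit : simple (unit_ : fus_cat);
  dual : fus_cat -> fus_cat;
  ev : forall X : fus_cat, hom (dual X \ox X) unit_;
  coev : forall X : fus_cat, hom unit_ (X \ox dual X);
  dualP : forall X : fus_cat, is_left_dual (ev X) (coev X);
  right_dualP : forall X : fus_cat,
    exists V (e : hom (X \ox V) unit_) (c : hom unit_ (V \ox X)),
      is_left_dual e c
}.

Arguments dual {K C} X : rename.
Arguments ev {K C} X : rename.
Arguments coev {K C} X : rename.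

Record fusion_subcategory K (C : fusionCategory K) (D : set C) : Prop := {
  fsub_unit : D unit_;
  fsub_tens : forall X Y, D X -> D Y -> D (X \ox Y);
  fsub_dual : forall X, D X -> D (dual X);
  fsub_sum : forall X n (s : 'I_n -> C),
    is_direct_sum X s -> (forall k, D (s k)) -> D X;
  fsub_summand : forall X n (s : 'I_n -> C),
    is_direct_sum X s -> D X -> forall k, D (s k)
}.

Definition fusion_coef K (C : fusionCategory K) (X Y Z : C) : nat :=
  \dim {: hom Z (X \ox Y)}.

(** ** Frobenius-Perron dimensions *)

Section FPdim.
Variables (R : realType) (K : fieldType) (C : fusionCategory K).
Implicit Types (X : C) (D : set C).

(* Representatives of the elements of O(D). *)
Definition irr D (i : 'I_(rank D)) : C :=
  xget (unit_ : {classic C}) (nth set0 (fset_set (simple_classes D)) i).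

(* Left multiplication by X on the Grothendieck ring of D. *)
Definition fusion_mx D X : 'M[R]_(rank D) :=
  \matrix_(i, j) (fusion_coef X (irr j) (irr i))%:R.

(* The largest nonnegative eigenvalue of [fusion_mx D X]; the set below is
   finite and, by the Frobenius-Perron theorem, nonempty when D is a fusion
   subcategory containing X. *)
Definition FPdim_simple D X : R :=
  sup [set a : R | 0 <= a /\ eigenvalue (fusion_mx D X) a].

(* Additive extension: the simple object [irr i] occurs in X with multiplicity
   dim Hom(irr i, X). *)
Definition FPdim D X : R :=
  \sum_(i < rank D) (\dim {: hom (irr i) X})%:R * FPdim_simple D (irr i).

Definition integral_subcategory D : Prop :=
  forall X, D X -> FPdim D X \is a Num.int.

End FPdim.

(** * Spherical structures and categorical dimensions *)

Section Duals.
Context {K : fieldType} {C : fusionCategory K}.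
Implicit Types X Y A : C.

(* The morphism A -> X* corresponding to a pairing of A with X under
   Hom(A (x) X, 1) = Hom(A, X* ). *)
Definition mate A X (p : hom (A \ox X) unit_) : hom A (dual X) :=
  lunit (dual X) \oc (p \om idm (dual X)) \oc assocV A X (dual X)
    \oc (idm A \om coev X) \oc runitV A.

Definition dualm X Y (f : hom X Y) : hom (dual Y) (dual X) :=
  mate (ev Y \oc (idm (dual Y) \om f)).

(* The canonical isomorphism from Y* (x) X* to (X (x) Y)*. *)
Definition dual_tens X Y : hom (dual Y \ox dual X) (dual (X \ox Y)) :=
  mate (ev Y \oc (idm (dual Y) \om
          (lunit Y \oc (ev X \om idm Y) \oc assocV (dual X) X Y))
        \oc assoc (dual Y) (dual X) (X \ox Y)).

(* The left trace of a : X -> X**, an endomorphism of the unit object. *)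
Definition ptrace X (a : hom X (dual (dual X))) : hom unit_ (unit_ : C) :=
  ev (dual X) \oc (a \om idm (dual X)) \oc coev X.

End Duals.

(* A pivotal structure is an isomorphism from the identity functor to the
   double dual functor, as monoidal functors.  The monoidal constraint
   X** (x) Y** -> (X (x) Y)** of the latter is the composite of
   [dual_tens (dual Y) (dual X)] with the inverse of
   [dualm (dual_tens X Y)]; in [piv_mon] this inverse is moved to the other
   side.  It is spherical if X and X* always have the same dimension. *)
Record spherical_structure (K : fieldType) (C : fusionCategory K) := Spherical {
  piv :> forall X : C, hom X (dual (dual X));
  piv_iso : forall X, is_iso (piv X);
  piv_nat : forall (X Y : C) (f : hom X Y),
    piv Y \oc f = dualm (dualm f) \oc piv X;
  piv_mon : forall X Y : C,
    dualm (dual_tens X Y) \oc piv (X \ox Y) =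
    dual_tens (dual Y) (dual X) \oc (piv X \om piv Y);
  piv_sph : forall X : C, ptrace (piv X) = ptrace (piv (dual X))
}.

(* End(1) consists of the scalar multiples of the identity (over an
   algebraically closed field, 1 being simple), which determines the scalar. *)
Definition cat_dim K (C : fusionCategory K) (a : spherical_structure C)
    (X : C) : K :=
  xget 0 [set c : K | ptrace (a X) = c *: idm unit_].

(** * Quadratic integers *)

(* Algebraic integers of degree at most 2 over the rationals. *)
Definition quadratic_integer (K : fieldType) (z : K) : Prop :=
  integralOver (intr : int -> K) z /\
  exists p : {poly rat}, [/\ p != 0, (size p <= 3)%N & root (map_poly ratr p) z].

(* Main.v *)
(* Let [x] and [y] be the dimensions of [rho1] and [rho2]. For [Y] in [D], the
   object [Y (x) rho_i] is a sum of copies of [rho1] and [rho2], so the vector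
   [(x, y)] is an eigenvector, with eigenvalue [dim Y], of a 2 x 2 matrix [M_Y]
   over the natural numbers, and the dual of [Y] acts by the transpose of [M_Y].
   Comparing the two, either [x = y = 0] or [y / x] is a nonzero real number,
   and [(x, y)] or its orthogonal is proportional to a positive vector [(1, w)],
   a joint eigenvector of all the [M_Y]. Its eigenvalues form a positive
   character of the Grothendieck ring of [D], hence are the Frobenius-Perron
   dimensions, which are integers; so [w] is rational, and so are [y / x] and
   the dimensions of the objects of [D]. Expanding [rho_i (x) rho_i] then gives
   a quadratic equation over the rationals, while [x] and [y] are eigenvalues of
   integral matrices. *)

From HB Require Import structures.
Require Import Defs.
From mathcomp Require Import finmap zify ring.

Set Implicit Arguments.
Unset Strict Implicit.
Unset Printing Implicit Defensive.

Import Order.TTheory GRing.Theory Num.Theory.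
Local Open Scope classical_set_scope.
Local Open Scope ring_scope.

(** * Linear and semisimple categories *)

Section Dimensions.
Context {K : fieldType}.
Implicit Types U V W : vectType K.

Lemma leq_dim_injective U V (f : U -> V) :
  linear f -> injective f -> (\dim {:U} <= \dim {:V})%N.
Proof.
move=> lf injf.
pose F : {linear U -> V} := HB.pack f (GRing.isLinear.Build _ _ _ _ f lf).
have kF : lker (linfun F) == 0%VS.
  by apply/lker0P => x y; rewrite !lfunE; apply: injf.
by rewrite -(limg_dim_eq (f := linfun F)) ?(eqP kF) ?capv0 // dimvS ?subvf.
Qed.

Lemma eq_dim_cancel U V (f : U -> V) (g : V -> U) :
  linear f -> linear g -> cancel f g -> cancel g f -> \dim {:U} = \dim {:V}.
Proof.
move=> lf lg fK gK; apply/eqP; rewrite eqn_leq.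
by rewrite (leq_dim_injective lf (can_inj fK))
           (leq_dim_injective lg (can_inj gK)).
Qed.

Lemma dim_biproduct V n (W : 'I_n -> vectType K)
    (i_ : forall k, W k -> V) (p_ : forall k, V -> W k) :
  (forall k, linear (i_ k)) ->
  (forall k, linear (p_ k)) ->
  (forall k w, p_ k (i_ k w) = w) ->
  (forall k l w, k != l -> p_ k (i_ l w) = 0) ->
  (forall v, \sum_k i_ k (p_ k v) = v) ->
  \dim {:V} = (\sum_k \dim {: W k})%N.
Proof.
move=> li lp ik ikl isum.
pose I k : {linear W k -> V} :=
  HB.pack (i_ k) (GRing.isLinear.Build _ _ _ _ (i_ k) (li k)).
pose P k : {linear V -> W k} :=
  HB.pack (p_ k) (GRing.isLinear.Build _ _ _ _ (p_ k) (lp k)).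
have fullE : fullv = (\sum_k limg (linfun (I k)))%VS :> {vspace V}.
  apply/eqP; rewrite eqEsubv subvf andbT; apply/subvP => v _.
  rewrite -(isum v); apply: memv_sumr => k _.
  have -> : i_ k (p_ k v) = linfun (I k) (p_ k v) by rewrite lfunE.
  by apply: memv_img; apply: memvf.
have dir : directv (\sum_k limg (linfun (I k))).
  apply/directv_sum_independent => us memu sum0 l _.
  have uE k : us k = i_ k (p_ k (us k)).
    have /memv_imgP[w _ ->] := memu k isT.
    by rewrite lfunE /= ik.
  have P0 : P l (\sum_k us k) = 0 by rewrite sum0 linear0.
  rewrite linear_sum (bigD1 l) //= big1 ?addr0 in P0.
    by rewrite uE P0 -[i_ l]/(I l : _ -> _) linear0.
  by move=> k kl; rewrite uE ikl // eq_sym.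
rewrite fullE (directvP dir) /=; apply: eq_bigr => k _.
have kI : lker (linfun (I k)) == 0%VS.
  apply/lker0P => x y; rewrite !(lfunE (I k)) /= => /(congr1 (p_ k)).
  by rewrite !ik.
by rewrite (limg_dim_eq (f := linfun (I k))) ?(eqP kI) ?capv0.
Qed.

End Dimensions.

Section LinearCategory.
Context {K : fieldType} {C : linCategory K}.
Implicit Types X Y Z : C.

Lemma compDl X Y Z (g g' : hom Y Z) (f : hom X Y) :
  (g + g') \oc f = (g \oc f) + (g' \oc f).
Proof. by have := comp_linl f 1 g g'; rewrite !scale1r. Qed.

Lemma compDr X Y Z (g : hom Y Z) (f f' : hom X Y) :
  g \oc (f + f') = (g \oc f) + (g \oc f').
Proof. by have := comp_linr g 1 f f'; rewrite !scale1r. Qed.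

Lemma comp0l X Y Z (f : hom X Y) : (0 : hom Y Z) \oc f = 0.
Proof. by apply: (addrI (0 \oc f)); rewrite -compDl !addr0. Qed.

Lemma comp0r X Y Z (g : hom Y Z) : g \oc (0 : hom X Y) = 0.
Proof. by apply: (addrI (g \oc 0)); rewrite -compDr !addr0. Qed.

Lemma compZl X Y Z c (g : hom Y Z) (f : hom X Y) :
  (c *: g) \oc f = c *: (g \oc f).
Proof. by have := comp_linl f c g 0; rewrite comp0l !addr0. Qed.

Lemma compZr X Y Z c (g : hom Y Z) (f : hom X Y) :
  g \oc (c *: f) = c *: (g \oc f).
Proof. by have := comp_linr g c f 0; rewrite comp0r !addr0. Qed.

Lemma compBr X Y Z (g : hom Y Z) (f f' : hom X Y) :
  g \oc (f - f') = (g \oc f) - (g \oc f').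
Proof. by rewrite compDr -scaleN1r compZr scaleN1r. Qed.

Lemma comp_suml X Y Z I (r : seq I) (g : I -> hom Y Z) (f : hom X Y) :
  (\sum_(i <- r) g i) \oc f = \sum_(i <- r) (g i \oc f).
Proof.
by elim/big_rec2: _ => [|i y1 y2 _ <-]; rewrite ?comp0l ?compDl.
Qed.

Lemma comp_sumr X Y Z I (r : seq I) (g : hom Y Z) (f : I -> hom X Y) :
  g \oc (\sum_(i <- r) f i) = \sum_(i <- r) (g \oc f i).
Proof.
by elim/big_rec2: _ => [|i y1 y2 _ <-]; rewrite ?comp0r ?compDr.
Qed.

Lemma isomorphic_refl X : isomorphic X X.
Proof. by exists (idm X), (idm X); split; rewrite comp_idl. Qed.

Lemma isomorphic_sym X Y : isomorphic X Y -> isomorphic Y X.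
Proof. by case=> f [g [fg gf]]; exists g, f. Qed.

Lemma isomorphic_trans Y X Z :
  isomorphic X Y -> isomorphic Y Z -> isomorphic X Z.
Proof.
case=> f [g [gf fg]] [f' [g' [gf' fg']]]; exists (f' \oc f), (g \oc g').
split.
  by rewrite comp_assoc -(comp_assoc g) gf' comp_idr.
by rewrite comp_assoc -(comp_assoc f') fg comp_idr.
Qed.

Lemma iso_classP X Y : iso_class X = iso_class Y <-> isomorphic X Y.
Proof.
split=> [XY | XY].
  have : iso_class Y Y by apply: isomorphic_refl.
  by rewrite -XY.
apply/seteqP; split=> Z.
  by apply: isomorphic_trans; apply: isomorphic_sym.
exact: isomorphic_trans.
Qed.

Lemma isomorphic_dim_homr A X Y :
  isomorphic X Y -> \dim {: hom A X} = \dim {: hom A Y}.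
Proof.
case=> f [g [gf fg]].
apply: (eq_dim_cancel (f := fun h => f \oc h) (g := fun h => g \oc h)).
- exact: comp_linr.
- exact: comp_linr.
- by move=> h; rewrite comp_assoc gf comp_idl.
- by move=> h; rewrite comp_assoc fg comp_idl.
Qed.

Lemma isomorphic_dim_homl A X Y :
  isomorphic X Y -> \dim {: hom X A} = \dim {: hom Y A}.
Proof.
case=> f [g [gf fg]].
apply: (eq_dim_cancel (f := fun h => h \oc g) (g := fun h => h \oc f)).
- exact: comp_linl.
- exact: comp_linl.
- by move=> h; rewrite -comp_assoc gf comp_idr.
- by move=> h; rewrite -comp_assoc fg comp_idr.
Qed.

Lemma dim_hom_sumr A X n (s : 'I_n -> C) :
  is_direct_sum X s ->
  \dim {: hom A X} = (\sum_k \dim {: hom A (s k)})%N.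
Proof.
case=> i_ [p_ [pi pi0 sumip]].
apply: (dim_biproduct (i_ := fun k h => i_ k \oc h)
                      (p_ := fun k h => p_ k \oc h)).
- by move=> k; apply: comp_linr.
- by move=> k; apply: comp_linr.
- by move=> k h; rewrite comp_assoc pi comp_idl.
- by move=> k l h kl; rewrite comp_assoc pi0 // comp0l.
- move=> h; rewrite -[RHS]comp_idl -sumip comp_suml.
  by apply: eq_bigr => k _; rewrite comp_assoc.
Qed.

Lemma dim_hom_suml A X n (s : 'I_n -> C) :
  is_direct_sum X s ->
  \dim {: hom X A} = (\sum_k \dim {: hom (s k) A})%N.
Proof.
case=> i_ [p_ [pi pi0 sumip]].
apply: (dim_biproduct (i_ := fun k h => h \oc p_ k)
                      (p_ := fun k h => h \oc i_ k)).
- by move=> k; apply: comp_linl.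
- by move=> k; apply: comp_linl.
- by move=> k h; rewrite -comp_assoc pi comp_idr.
- by move=> k l h kl; rewrite -comp_assoc pi0 ?comp0r // eq_sym.
- move=> h; rewrite -[RHS]comp_idr -sumip comp_sumr.
  by apply: eq_bigr => k _; rewrite comp_assoc.
Qed.

Lemma isomorphic_direct_sum X Y :
  isomorphic X Y -> is_direct_sum X (fun _ : 'I_1 => Y).
Proof.
case=> f [g [gf fg]]; exists (fun=> g), (fun=> f); split=> [//|k l|].
  by rewrite !ord1.
by rewrite big_ord1.
Qed.

Lemma isomorphic_simple X Y : isomorphic X Y -> simple X -> simple Y.
Proof.
case=> f [g [gf fg]] [nzX sX]; split=> [Y0 | U u mu].
  by apply: nzX; rewrite /is_zero_object -gf -(comp_idl f) Y0 comp0l comp0r.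
have mgu : is_mono (g \oc u).
  move=> Z v w; rewrite -!comp_assoc => /(congr1 (comp f)).
  by rewrite !comp_assoc fg !comp_idl; apply: mu.
have [|[h [h1 h2]]] := sX _ _ mgu; [by left | right].
exists (h \oc g); split; first by rewrite -comp_assoc h1.
rewrite comp_assoc -[u]comp_idl -fg -(comp_assoc f) -(comp_assoc f) h2.
by rewrite comp_idr fg.
Qed.

Lemma dim_hom_gt0 X Y : (0 < \dim {: hom X Y})%N <-> exists f : hom X Y, f != 0.
Proof.
split=> [d0|[f nzf]].
  exists (vpick fullv); rewrite vpick0.
  by apply: contraL d0 => /eqP ->; rewrite dimv0.
rewrite lt0n dimv_eq0; apply: contra_neq nzf => full0.
by apply/eqP; rewrite -memv0 -full0 memvf.
Qed.

End LinearCategory.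

Import VectorInternalTheory.

Section Schur.
Context {K : closedFieldType} {C : linCategory K}.
Hypothesis abC : abelian_category C.
Implicit Types X Y S T : C.

Lemma simple_iso S T (f : hom S T) : simple S -> simple T -> f != 0 -> is_iso f.
Proof.
have [_ kerC _ _ _] := abC.
move=> [nzS simS] [nzT simT] nzf.
have [U [k [fk0 kU]]] := kerC _ _ f.
have mk : is_mono k.
  move=> Z u v kuv.
  have [|h [_ uniqh]] := kU Z (k \oc u); first by rewrite comp_assoc fk0 comp0l.
  by rewrite -(uniqh u) // -(uniqh v).
have [U0 | [h [_ kh]]] := simS _ _ mk; last first.
  by case/eqP: nzf; rewrite -[f]comp_idr -kh comp_assoc fk0 comp0l.
have mf : is_mono f.
  move=> Z u v fuv.
  have [|h [kh _]] := kU Z (u - v); first by rewrite compBr fuv subrr.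
  by apply/eqP; rewrite -subr_eq0 -kh -[h]comp_idl U0 comp0l comp0r.
by have [|] := simT _ _ mf.
Qed.

Lemma dim_hom_not_iso S T :
  simple S -> simple T -> ~ isomorphic S T -> \dim {: hom S T} = 0.
Proof.
move=> sS sT nST; apply/eqP; rewrite -leqn0 leqNgt.
apply/negP => /dim_hom_gt0[f nzf]; apply: nST.
by exists f; apply: simple_iso.
Qed.

Lemma simple_endo S (f : hom S S) : simple S -> exists c, f = c *: idm S.
Proof.
move=> sS; pose F : {linear hom S S -> hom S S} :=
  HB.pack (fun h => f \oc h)
          (GRing.isLinear.Build _ _ _ _ (fun h => f \oc h) (comp_linr f)).
have nz1 : idm S != 0 by apply/eqP; case: sS.
have [n dimE] : exists n, dim (hom S S) = n.+1.
  have : (0 < \dim {:hom S S})%N by apply/dim_hom_gt0; exists (idm S).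
  by rewrite dimvf; case: dim => // n _; exists n.
pose A : 'M[K]_(dim (hom S S)) := lin1_mx (v2r \o F \o r2v).
have [c eigc] : exists c, eigenvalue A c.
  have : size (char_poly A) != 1 by rewrite size_char_poly dimE.
  by case/closed_rootP => c rc; exists c; rewrite eigenvalue_root_char.
have [v vE nzv] := eigenvalueP eigc.
exists c; apply: contrapT => nfc.
have nzfc : f - c *: idm S != 0 by rewrite subr_eq0; apply/eqP.
have [g [gK _]] := simple_iso sS sS nzfc.
case/eqP: nzv; apply: (can_inj r2vK); rewrite linear0.
have /(congr1 r2v) := vE; rewrite mul_rV_lin1 /= v2rK linearZ /= => fv.
rewrite -[r2v v]comp_idl -gK -comp_assoc compDl -scaleNr compZl comp_idl fv.
by rewrite scaleNr subrr comp0r.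
Qed.

Lemma dim_hom_iso S T :
  simple S -> isomorphic S T -> \dim {: hom S T} = 1.
Proof.
move=> sS ST; rewrite -(isomorphic_dim_homr _ ST).
have -> : fullv = <[idm S]>%VS :> {vspace hom S S}.
  apply/eqP; rewrite eqEsubv subvf andbT; apply/subvP => f _.
  by have [c ->] := simple_endo f sS; rewrite memvZ ?memv_line.
by rewrite dim_vline; case: sS => /eqP ->.
Qed.

Hypothesis ssC : semisimple C.

Lemma dim_hom_sym X Y : \dim {: hom X Y} = \dim {: hom Y X}.
Proof.
have [n [s [ss Xs]]] := ssC X; have [m [t [st Yt]]] := ssC Y.
rewrite (dim_hom_suml _ Xs) (dim_hom_sumr _ Xs); apply: eq_bigr => k _.
rewrite (dim_hom_suml _ Yt) (dim_hom_sumr _ Yt); apply: eq_bigr => l _.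
have [kl|nkl] := pselect (isomorphic (s k) (t l)).
  by rewrite !dim_hom_iso //; apply: isomorphic_sym.
by rewrite !dim_hom_not_iso // => /isomorphic_sym.
Qed.

Definition additive_on_sums (V : nmodType) (phi : C -> V) : Prop :=
  forall X n (s : 'I_n -> C), is_direct_sum X s -> phi X = \sum_k phi (s k).

Lemma additive_isomorphic (V : nmodType) (phi : C -> V) X Y :
  additive_on_sums phi -> isomorphic X Y -> phi X = phi Y.
Proof. by move=> add /isomorphic_direct_sum/add; rewrite big_ord1. Qed.

Lemma additive_expand (V : nmodType) (phi : C -> V) (I : finType) (t : I -> C)
    X :
  additive_on_sums phi ->
  (forall i, simple (t i)) ->
  (forall i j, isomorphic (t i) (t j) -> i = j) ->
  (forall S, simple S -> (0 < \dim {: hom S X})%N ->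
     exists i, isomorphic S (t i)) ->
  phi X = \sum_i phi (t i) *+ \dim {: hom (t i) X}.
Proof.
move=> add st tinj cov; have [n [s [ss Xs]]] := ssC X.
rewrite (add _ _ _ Xs).
under [RHS]eq_bigr => i _ do
  rewrite (dim_hom_sumr _ Xs) -sumrMnr.
rewrite exchange_big; apply: eq_bigr => k _ /=.
have [|i ski] := cov _ (ss k).
  rewrite (dim_hom_sumr _ Xs) (bigD1 k) //= dim_hom_iso //.
  exact: isomorphic_refl.
rewrite (bigD1 i) //= big1 ?addr0.
  rewrite dim_hom_iso ?(additive_isomorphic add ski) //.
  exact: isomorphic_sym.
move=> j nji; rewrite dim_hom_not_iso // => tjk.
case/eqP: nji; apply: tinj.
exact: isomorphic_trans tjk ski.
Qed.

End Schur.

(** * Monoidal categories and duals *)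

Section Monoidal.
Context {K : fieldType} {C : monCategory K}.
Implicit Types X Y Z V A B : C.

Lemma comp_eqr X Y Y' Z W (h : hom Z W) (b : hom Y Z) (c : hom X Y)
    (b' : hom Y' Z) (c' : hom X Y') :
  b \oc c = b' \oc c' -> h \oc b \oc c = h \oc b' \oc c'.
Proof. by move=> E; rewrite -!comp_assoc E. Qed.

Lemma comp_eqr1 X Y Z W (h : hom Z W) (b : hom Y Z) (c : hom X Y)
    (d : hom X Z) :
  b \oc c = d -> h \oc b \oc c = h \oc d.
Proof. by move=> E; rewrite -!comp_assoc E. Qed.

Lemma comp_cancel Y Z W (h : hom Z W) (b : hom Y Z) (c : hom Z Y) :
  b \oc c = idm Z -> h \oc b \oc c = h.
Proof. by move=> E; rewrite -!comp_assoc E comp_idr. Qed.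

Lemma tensm_compr X Y Y' Y'' (g : hom Y' Y'') (f : hom Y Y') :
  idm X \om (g \oc f) = (idm X \om g) \oc (idm X \om f).
Proof. by rewrite -tensm_comp comp_idl. Qed.

Lemma tensm_compl X Y Y' Y'' (g : hom Y' Y'') (f : hom Y Y') :
  (g \oc f) \om idm X = (g \om idm X) \oc (f \om idm X).
Proof. by rewrite -tensm_comp comp_idl. Qed.

Lemma tensmEl X X' Y Y' (f : hom X X') (g : hom Y Y') :
  f \om g = (f \om idm Y') \oc (idm X \om g).
Proof. by rewrite -tensm_comp comp_idl comp_idr. Qed.

Lemma tensmEr X X' Y Y' (f : hom X X') (g : hom Y Y') :
  f \om g = (idm X' \om g) \oc (f \om idm Y).
Proof. by rewrite -tensm_comp comp_idl comp_idr. Qed.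

Lemma tensmDl X X' Y Y' (f f' : hom X X') (g : hom Y Y') :
  (f + f') \om g = (f \om g) + (f' \om g).
Proof. by have := tensm_linl 1 f f' g; rewrite !scale1r. Qed.

Lemma tensm0l X X' Y Y' (g : hom Y Y') : (0 : hom X X') \om g = 0.
Proof. by apply: (addrI (0 \om g)); rewrite -tensmDl !addr0. Qed.

Lemma tensmZl X X' Y Y' k (f : hom X X') (g : hom Y Y') :
  (k *: f) \om g = k *: (f \om g).
Proof. by have := tensm_linl k f 0 g; rewrite tensm0l !addr0. Qed.

Lemma tensm_suml X X' Y Y' I (r : seq I) (f : I -> hom X X') (g : hom Y Y') :
  (\sum_(i <- r) f i) \om g = \sum_(i <- r) (f i \om g).
Proof.
by elim/big_rec2: _ => [|i y1 y2 _ <-]; rewrite ?tensm0l ?tensmDl.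
Qed.

Lemma tensmDr X X' Y Y' (f : hom X X') (g g' : hom Y Y') :
  f \om (g + g') = (f \om g) + (f \om g').
Proof. by have := tensm_linr 1 f g g'; rewrite !scale1r. Qed.

Lemma tensm0r X X' Y Y' (f : hom X X') : f \om (0 : hom Y Y') = 0.
Proof. by apply: (addrI (f \om 0)); rewrite -tensmDr !addr0. Qed.

Lemma tensmZr X X' Y Y' k (f : hom X X') (g : hom Y Y') :
  f \om (k *: g) = k *: (f \om g).
Proof. by have := tensm_linr k f g 0; rewrite tensm0r !addr0. Qed.

Lemma tensm_sumr X X' Y Y' I (r : seq I) (f : hom X X') (g : I -> hom Y Y') :
  f \om (\sum_(i <- r) g i) = \sum_(i <- r) (f \om g i).
Proof.
by elim/big_rec2: _ => [|i y1 y2 _ <-]; rewrite ?tensm0r ?tensmDr.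
Qed.

Lemma tensm_exchange X X' Y Y' (f : hom X X') (g : hom Y Y') :
  (f \om idm Y') \oc (idm X \om g) = (idm X' \om g) \oc (f \om idm Y).
Proof. by rewrite -tensmEl tensmEr. Qed.

Lemma assocV_nat X X' Y Y' Z Z' (f : hom X X') (g : hom Y Y') (h : hom Z Z') :
  assocV X' Y' Z' \oc (f \om (g \om h)) = (f \om g) \om h \oc assocV X Y Z.
Proof.
rewrite -[LHS]comp_idr -(assocK X Y Z).2 comp_assoc -(comp_assoc _ _ (assoc _ _
  _)).
by rewrite -assoc_nat comp_assoc (assocK _ _ _).1 comp_idl.
Qed.

Lemma lunitV_nat X Y (f : hom X Y) :
  lunitV Y \oc f = (idm unit_ \om f) \oc lunitV X.
Proof.
rewrite -[LHS]comp_idr -(lunitK X).2 comp_assoc -(comp_assoc _ f).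
by rewrite -lunit_nat comp_assoc (lunitK _).1 comp_idl.
Qed.

Lemma tens_unit_faithful X Y (f g : hom X Y) :
  idm unit_ \om f = idm unit_ \om g -> f = g.
Proof.
move=> fg; rewrite -[f]comp_idr -[g]comp_idr -(lunitK X).2 !comp_assoc.
by rewrite -!lunit_nat fg.
Qed.

(* Kelly's redundancy of the second unit axiom. *)
Lemma lunit_tens X Y :
  lunit (X \ox Y) \oc assoc unit_ X Y = lunit X \om idm Y.
Proof.
apply: tens_unit_faithful; set f := LHS; set g := RHS.
suff E : f \oc (assoc unit_ (unit_ \ox X) Y \oc (assoc unit_ unit_ X \om idm Y))
       = g \oc (assoc unit_ (unit_ \ox X) Y \oc (assoc unit_ unit_ X \om idm
         Y)).
  rewrite -[f]comp_idr -[g]comp_idr -(assocK unit_ (unit_ \ox X) Y).2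
    !comp_assoc.
  congr (_ \oc _).
  rewrite -[LHS]comp_idr -[RHS]comp_idr -tensm_id -(assocK unit_ unit_ X).2.
  by rewrite tensm_compl !comp_assoc -!(comp_assoc _ (assoc _ _ _)) E.
rewrite {}/f {}/g tensm_compr -!comp_assoc.
rewrite (comp_assoc (_ \om assoc _ _ _)) -pentagon comp_assoc triangle
  comp_assoc -assoc_nat -comp_assoc.
by rewrite -tensm_compl triangle -tensm_id assoc_nat.
Qed.

Lemma lunit_tensV X Y :
  (lunit X \om idm Y) \oc assocV unit_ X Y = lunit (X \ox Y).
Proof. by rewrite -lunit_tens comp_cancel // (assocK _ _ _).2. Qed.

Lemma lunitV_tens X Y :
  assoc unit_ X Y \oc (lunitV X \om idm Y) = lunitV (X \ox Y).
Proof.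
rewrite -[LHS]comp_idl -(lunitK (X \ox Y)).1 -comp_assoc.
rewrite (comp_assoc (lunit _)) lunit_tens -tensm_compl.
by rewrite (lunitK X).2 tensm_id comp_idr.
Qed.

Lemma triangleV X Y :
  runitV X \om idm Y = assocV X unit_ Y \oc (idm X \om lunitV Y).
Proof.
rewrite -[LHS]comp_idl -(assocK X unit_ Y).1 -comp_assoc; congr (_ \oc _).
rewrite -[LHS]comp_idl -tensm_id -(lunitK Y).1 tensm_compr -comp_assoc.
rewrite (comp_assoc (_ \om lunit _)) triangle -tensm_compl (runitK X).2.
by rewrite tensm_id comp_idr.
Qed.

Lemma pentagonV X Y Z W :
  (assocV X Y Z \om idm W) \oc assocV X (Y \ox Z) W =
  assocV (X \ox Y) Z W \oc assocV X Y (Z \ox W) \oc (idm X \om assoc Y Z W).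
Proof.
rewrite -[LHS]comp_idl -(assocK (X \ox Y) Z W).1 -!comp_assoc; congr (_ \oc _).
rewrite -[LHS]comp_idl -(assocK X Y (Z \ox W)).1 -!comp_assoc; congr (_ \oc _).
rewrite (comp_assoc (assoc X Y _)) pentagon !comp_assoc.
rewrite -(comp_assoc _ (assoc X Y Z \om _)) -tensm_compl (assocK _ _ _).2.
by rewrite tensm_id comp_idr comp_cancel // (assocK _ _ _).2.
Qed.

Lemma pentagon_mid X Y Z W :
  assoc X (Y \ox Z) W \oc (assoc X Y Z \om idm W) =
  (idm X \om assocV Y Z W) \oc assoc X Y (Z \ox W) \oc assoc (X \ox Y) Z W.
Proof.
rewrite -comp_assoc pentagon !comp_assoc -tensm_compr (assocK _ _ _).1.
by rewrite tensm_id comp_idl.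
Qed.

Lemma pentagon_assocV X Y Z W :
  (assoc X Y Z \om idm W) \oc assocV (X \ox Y) Z W =
  assocV X (Y \ox Z) W \oc (idm X \om assocV Y Z W) \oc assoc X Y (Z \ox W).
Proof.
rewrite -[LHS]comp_idl -(assocK X (Y \ox Z) W).1 -!comp_assoc; congr (_ \oc _).
rewrite (comp_assoc (assoc X _ W)) pentagon_mid comp_cancel ?comp_assoc //.
exact: (assocK _ _ _).2.
Qed.

(* The actions on [A] of pairings and copairings: with the associators absorbed
   here, the calculus of duals takes place in the strict monoidal category of
   endofunctors. *)
Definition pair_act V X (p : hom (V \ox X) unit_) A : hom (V \ox (X \ox A)) A :=
  locked (lunit A \oc (p \om idm A) \oc assocV V X A).

Definition copair_act X V (c : hom unit_ (X \ox V)) A :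
  hom A (X \ox (V \ox A)) := locked (assoc X V A \oc (c \om idm A) \oc lunitV
    A).

Lemma pair_actE V X (p : hom (V \ox X) unit_) A :
  pair_act p A = lunit A \oc (p \om idm A) \oc assocV V X A.
Proof. by rewrite /pair_act -lock. Qed.

Lemma copair_actE X V (c : hom unit_ (X \ox V)) A :
  copair_act c A = assoc X V A \oc (c \om idm A) \oc lunitV A.
Proof. by rewrite /copair_act -lock. Qed.

Lemma pair_act_nat V X (p : hom (V \ox X) unit_) A B (f : hom A B) :
  pair_act p B \oc (idm V \om (idm X \om f)) = f \oc pair_act p A.
Proof.
rewrite !pair_actE -!comp_assoc assocV_nat tensm_id !comp_assoc.
by rewrite (comp_eqr _ (tensm_exchange _ _)) lunit_nat.
Qed.

Lemma copair_act_nat X V (c : hom unit_ (X \ox V)) A B (f : hom A B) :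
  (idm X \om (idm V \om f)) \oc copair_act c A = copair_act c B \oc f.
Proof.
rewrite !copair_actE !comp_assoc -assoc_nat tensm_id.
rewrite (comp_eqr _ (esym (tensm_exchange _ _))).
by rewrite (comp_eqr _ (esym (lunitV_nat _))).
Qed.

Definition gen_mate X V (c : hom unit_ (X \ox V)) A
    (p : hom (A \ox X) unit_) : hom A V :=
  lunit V \oc (p \om idm V) \oc assocV A X V \oc (idm A \om c) \oc runitV A.

Lemma gen_mate_act X V (c : hom unit_ (X \ox V)) A (p : hom (A \ox X) unit_) B :
  gen_mate c p \om idm B =
  pair_act p (V \ox B) \oc (idm A \om copair_act c B).
Proof.
rewrite /gen_mate !tensm_compl triangleV comp_assoc.
rewrite (comp_eqr _ (esym (assocV_nat _ _ _))).
rewrite (comp_eqr _ (pentagonV _ _ _ _)) !comp_assoc.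
rewrite (comp_eqr _ (esym (assocV_nat _ _ _))) lunit_tensV tensm_id.
by rewrite !pair_actE !copair_actE !tensm_compr !comp_assoc.
Qed.

Section LeftDual.
Variables (X V : C) (e : hom (V \ox X) unit_) (c : hom unit_ (X \ox V)).
Hypothesis dualXV : is_left_dual e c.

Lemma left_dual_zigzag A :
  (idm X \om pair_act e A) \oc copair_act c (X \ox A) = idm (X \ox A).
Proof.
have [/(congr1 (fun f => f \om idm A))] := dualXV.
rewrite tensm_id => <- _; rewrite !tensm_compl -triangle.
rewrite (comp_eqr _ (assoc_nat _ _ _)) (comp_eqr _ (pentagon_mid _ _ _ _)).
rewrite !comp_assoc (comp_eqr _ (assoc_nat _ _ _)) (comp_eqr1 _ (lunitV_tens _
  _)).
by rewrite tensm_id !pair_actE !copair_actE !tensm_compr ?comp_assoc.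
Qed.

Lemma left_dual_zagzig A :
  pair_act e (V \ox A) \oc (idm V \om copair_act c A) = idm (V \ox A).
Proof.
have [_ /(congr1 (fun f => f \om idm A))] := dualXV.
by rewrite -/(gen_mate c e) gen_mate_act tensm_id.
Qed.

Lemma pair_act_gen_mate A (p : hom (A \ox X) unit_) B :
  pair_act e B \oc (gen_mate c p \om idm (X \ox B)) = pair_act p B.
Proof.
rewrite gen_mate_act comp_assoc -pair_act_nat -comp_assoc -tensm_compr.
by rewrite left_dual_zigzag tensm_id comp_idr.
Qed.

Lemma dim_hom_adjoint A B :
  \dim {: hom (V \ox A) B} = \dim {: hom A (X \ox B)}.
Proof.
apply: (eq_dim_cancel (f := fun h => (idm X \om h) \oc copair_act c A)
                      (g := fun h => pair_act e B \oc (idm V \om h))).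
- by move=> k f g; rewrite tensm_linr comp_linl.
- by move=> k f g; rewrite tensm_linr comp_linr.
- move=> h /=; rewrite tensm_compr comp_assoc pair_act_nat -comp_assoc.
  by rewrite left_dual_zagzig comp_idr.
- move=> h /=; rewrite tensm_compr -comp_assoc copair_act_nat comp_assoc.
  by rewrite left_dual_zigzag comp_idl.
Qed.

(* Adjoints are unique: a copairing is recovered from any adjunction whose
   counit factors through the pairing. *)
Lemma copair_act_unique (F : C -> C) (Fm : forall A B, hom A B -> hom (F A) (F
  B))
    (j : forall A, hom (F A) (V \ox A)) (e' : forall A, hom (F (X \ox A)) A)
    (c' : forall A, hom A (X \ox F A)) :
  (forall A B (f : hom A B), j B \oc Fm _ _ f = (idm V \om f) \oc j A) ->
  (forall A B (f : hom A B), (idm X \om Fm _ _ f) \oc c' A = c' B \oc f) ->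
  (forall A, pair_act e A \oc j (X \ox A) = e' A) ->
  (forall A, (idm X \om e' A) \oc c' (X \ox A) = idm (X \ox A)) ->
  forall A, (idm X \om j A) \oc c' A = copair_act c A.
Proof.
move=> jnat c'nat ej zz A.
rewrite -[j A]comp_idl -left_dual_zagzig -(comp_assoc (pair_act _ _)) -jnat.
by rewrite comp_assoc ej tensm_compr -comp_assoc c'nat comp_assoc zz comp_idl.
Qed.

End LeftDual.
End Monoidal.

(** * Categorical dimension *)

Section Duality.
Context {K : fieldType} {C : fusionCategory K}.
Implicit Types X Y A B : C.

Lemma mate_act A X (p : hom (A \ox X) unit_) B :
  mate p \om idm B =
  pair_act p (dual X \ox B) \oc (idm A \om copair_act (coev X) B).
Proof. exact: (gen_mate_act (coev X)). Qed.

Lemma pair_act_mate A X (p : hom (A \ox X) unit_) B :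
  pair_act (ev X) B \oc (mate p \om idm (X \ox B)) = pair_act p B.
Proof. exact: (pair_act_gen_mate (dualP X)). Qed.

Lemma pair_act_tensr X Y A (p : hom (A \ox Y) unit_) (f : hom X Y) B :
  pair_act (p \oc (idm A \om f)) B =
  pair_act p B \oc (idm A \om (f \om idm B)).
Proof.
rewrite !pair_actE tensm_compl comp_assoc -!comp_assoc assocV_nat.
by rewrite !comp_assoc.
Qed.

Lemma pair_act_dualm X Y (f : hom X Y) B :
  pair_act (ev X) B \oc (dualm f \om idm (X \ox B)) =
  pair_act (ev Y) B \oc (idm (dual Y) \om (f \om idm B)).
Proof. by rewrite pair_act_mate pair_act_tensr. Qed.

Lemma copair_act_dualm X Y (f : hom X Y) B :
  (idm Y \om (dualm f \om idm B)) \oc copair_act (coev Y) B =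
  (f \om idm (dual X \ox B)) \oc copair_act (coev X) B.
Proof.
rewrite mate_act pair_act_tensr !tensm_compr -!comp_assoc.
rewrite copair_act_nat [X in _ \oc X]comp_assoc copair_act_nat !comp_assoc.
by rewrite (left_dual_zigzag (dualP Y)) comp_idl.
Qed.

Lemma pair_act_dual_tens X Y B :
  pair_act (ev (X \ox Y)) B \oc (dual_tens X Y \om idm ((X \ox Y) \ox B)) =
  pair_act (ev Y) B \oc (idm (dual Y) \om pair_act (ev X) (Y \ox B)) \oc
  (idm (dual Y) \om (idm (dual X) \om assoc X Y B)) \oc
  assoc (dual Y) (dual X) ((X \ox Y) \ox B).
Proof.
rewrite pair_act_mate; set phi := lunit Y \oc _ \oc _.
have phi_act : (phi \om idm B) \oc assocV (dual X) (X \ox Y) B =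
    pair_act (ev X) (Y \ox B) \oc (idm (dual X) \om assoc X Y B).
  rewrite /phi !tensm_compl -!comp_assoc pentagonV !pair_actE -lunit_tensV.
  by rewrite !comp_assoc (comp_eqr _ (esym (assocV_nat _ _ _))) tensm_id.
clearbody phi; rewrite -[X in _ = X \oc _]comp_assoc -tensm_compr -phi_act
  tensm_compr.
rewrite !pair_actE !tensm_compl -!comp_assoc pentagon_assocV !comp_assoc.
by rewrite (comp_eqr _ (esym (assocV_nat _ _ _))).
Qed.

Lemma ptrace_act X (a : hom X (dual (dual X))) A :
  lunit A \oc (ptrace a \om idm A) \oc lunitV A =
  pair_act (ev (dual X)) A \oc (a \om idm (dual X \ox A)) \oc
  copair_act (coev X) A.
Proof.
rewrite !pair_actE !copair_actE /ptrace !tensm_compl !comp_assoc -tensm_id.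
rewrite (comp_eqr _ (assocV_nat _ _ _)).
by rewrite (comp_cancel _ (assocK _ _ _).1).
Qed.

Lemma dual_tens_copair X Y A :
  (idm (X \ox Y) \om
     ((dual_tens X Y \om idm A) \oc assocV (dual Y) (dual X) A)) \oc
  (assocV X Y (dual Y \ox (dual X \ox A)) \oc
   (idm X \om copair_act (coev Y) (dual X \ox A)) \oc copair_act (coev X) A) =
  copair_act (coev (X \ox Y)) A.
Proof.
apply: (copair_act_unique (dualP (X \ox Y))
  (F := fun A => dual Y \ox (dual X \ox A))
  (Fm := fun A B f => idm (dual Y) \om (idm (dual X) \om f))
  (j := fun A => (dual_tens X Y \om idm A) \oc assocV (dual Y) (dual X) A)
  (e' := fun A => pair_act (ev Y) A \oc
     (idm (dual Y) \om pair_act (ev X) (Y \ox A)) \oc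
     (idm (dual Y) \om (idm (dual X) \om assoc X Y A)))
  (c' := fun A => assocV X Y (dual Y \ox (dual X \ox A)) \oc
     (idm X \om copair_act (coev Y) (dual X \ox A)) \oc
     copair_act (coev X) A)) => [B D f|B D f|B|B].
- rewrite -comp_assoc assocV_nat tensm_id !comp_assoc.
  by rewrite tensm_exchange.
- rewrite -tensm_id !comp_assoc -assocV_nat -[RHS]comp_assoc -copair_act_nat.
  rewrite comp_assoc; congr (_ \oc _); rewrite -!comp_assoc; congr (_ \oc _).
  by rewrite -!tensm_compr copair_act_nat.
- rewrite comp_assoc pair_act_dual_tens comp_cancel // (assocK _ _ _).2.
  by [].
- rewrite -(tensm_id X Y) !comp_assoc -assocV_nat !tensm_compr -!comp_assoc.
  rewrite (comp_assoc _ (idm X \om copair_act _ _)) -(tensm_compr X)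
    copair_act_nat.
  rewrite tensm_compr -!comp_assoc copair_act_nat.
  rewrite (comp_assoc _ (idm X \om copair_act _ _)) -(tensm_compr X)
    copair_act_nat.
  rewrite tensm_compr -!comp_assoc (comp_assoc _ (copair_act _ _)).
  rewrite (left_dual_zigzag (dualP X)) comp_idl.
  rewrite (comp_assoc _ (idm X \om copair_act _ _)) -(tensm_compr X).
  rewrite (left_dual_zigzag (dualP Y)) tensm_id comp_idl.
  exact: (assocK _ _ _).1.
Qed.
End Duality.

Section CategoricalDimension.
Context {K : closedFieldType} {C : fusionCategory K}.
Variable a : spherical_structure C.
Implicit Types X Y A B : C.

Lemma scale_unit_inj (c c' : K) : c *: idm (unit_ : C) = c' *: idm unit_ -> c =
  c'.
Proof.
have [/eqP nz1 _] := fus_unit C => /eqP; rewrite -subr_eq0 -scalerBl scaler_eq0.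
by rewrite subr_eq0 (negPf nz1) orbF => /eqP.
Qed.

Lemma cat_dimE X : ptrace (a X) = cat_dim a X *: idm unit_.
Proof.
have [c cE] := simple_endo (fus_abelian C) (ptrace (a X)) (fus_unit C).
have /= := @xgetPex _ 0 [set c : K | ptrace (a X) = c *: idm unit_].
by apply; exists c.
Qed.

Lemma cat_dim_act X A :
  pair_act (ev (dual X)) A \oc (a X \om idm (dual X \ox A)) \oc
    copair_act (coev X) A = cat_dim a X *: idm A.
Proof.
rewrite -ptrace_act cat_dimE tensmZl tensm_id compZr compZl comp_idr.
by rewrite (lunitK A).2.
Qed.

Lemma cat_dim_tens X Y : cat_dim a (X \ox Y) = cat_dim a X * cat_dim a Y.
Proof.
apply: scale_unit_inj; rewrite -cat_dim_act -dual_tens_copair.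
set A := unit_; set j := _ \oc assocV (dual Y) _ _.
rewrite comp_assoc -(comp_assoc (pair_act _ _)) tensm_exchange.
rewrite /j tensm_compr !comp_assoc -pair_act_dualm.
rewrite (comp_eqr _ (esym (tensm_exchange (a _) (assocV _ _ _)))).
rewrite -(comp_assoc _ (dualm _ \om _)) -tensm_compl piv_mon tensm_compl
  comp_assoc.
rewrite pair_act_dual_tens (comp_eqr _ (assoc_nat _ _ _)) -(tensm_id X Y).
rewrite (comp_eqr _ (assoc_nat _ _ _)) (comp_cancel _ (assocK _ _ _).2).
rewrite -tensm_id -!(comp_assoc _ (_ \om (_ \om assoc _ _ _))).
rewrite -!(comp_assoc _ (_ \om (_ \om _))) -!tensm_comp.
rewrite tensm_id !comp_idl !comp_idr -(comp_assoc _ (a X \om _)) -tensm_comp.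
rewrite comp_assoc -tensm_comp !comp_idr (assocK _ _ _).2.
rewrite -comp_assoc -comp_assoc (comp_assoc _ (a X \om _)) -tensm_comp.
rewrite comp_idl (comp_assoc (pair_act (ev (dual Y)) _)) cat_dim_act.
by rewrite tensmZr compZl compZr comp_assoc cat_dim_act scalerA mulrC.
Qed.

Lemma cat_dim_sum : additive_on_sums (cat_dim a).
Proof.
move=> X n s [i_ [p_ [pi _ sumip]]]; apply: scale_unit_inj.
rewrite scaler_suml -cat_dim_act -[a X]comp_idr -sumip comp_sumr.
rewrite tensm_suml comp_sumr comp_suml; apply: eq_bigr => k _.
rewrite comp_assoc piv_nat tensm_compl tensm_compl !comp_assoc.
rewrite pair_act_dualm.
rewrite (comp_eqr _ (esym (tensm_exchange _ _))).
rewrite (comp_eqr _ (esym (tensm_exchange _ _))).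
rewrite (comp_eqr _ (copair_act_dualm _ _)) -(comp_assoc _ (p_ k \om _)).
by rewrite -tensm_compl pi tensm_id comp_idr cat_dim_act.
Qed.

End CategoricalDimension.

(** * Fusion subcategories *)

Section FusionCoefficients.
Context {K : closedFieldType} {C : fusionCategory K}.
Implicit Types X Y Z A B S : C.

Let abC := fus_abelian C.
Let ssC := @fus_semisimple _ C.

Lemma direct_sum_tensl X n (s : 'I_n -> C) B :
  is_direct_sum X s -> is_direct_sum (X \ox B) (fun k => s k \ox B).
Proof.
case=> i_ [p_ [pi pi0 sumip]].
exists (fun k => i_ k \om idm B), (fun k => p_ k \om idm B); split=> [k|k l
  kl|].
- by rewrite -tensm_compl pi tensm_id.
- by rewrite -tensm_compl pi0 // tensm0l.
- by under eq_bigr do rewrite -tensm_compl; rewrite -tensm_suml sumip tensm_id.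
Qed.

Lemma direct_sum_tensr X n (s : 'I_n -> C) B :
  is_direct_sum X s -> is_direct_sum (B \ox X) (fun k => B \ox s k).
Proof.
case=> i_ [p_ [pi pi0 sumip]].
exists (fun k => idm B \om i_ k), (fun k => idm B \om p_ k); split=> [k|k l
  kl|].
- by rewrite -tensm_compr pi tensm_id.
- by rewrite -tensm_compr pi0 // tensm0r.
- by under eq_bigr do rewrite -tensm_compr; rewrite -tensm_sumr sumip tensm_id.
Qed.

Lemma additive_tensl (V : nmodType) (phi : C -> V) B :
  additive_on_sums phi -> additive_on_sums (fun X => phi (X \ox B)).
Proof. by move=> add X n s /(direct_sum_tensl B)/add. Qed.

Lemma additive_tensr (V : nmodType) (phi : C -> V) B :
  additive_on_sums phi -> additive_on_sums (fun X => phi (B \ox X)).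
Proof. by move=> add X n s /(direct_sum_tensr B)/add. Qed.

Lemma additive_dim_hom A : additive_on_sums (fun X => \dim {: hom A X}).
Proof. by move=> X n s /(dim_hom_sumr A). Qed.

Lemma fusion_coef_dual X A B :
  fusion_coef (dual X) A B = fusion_coef X B A.
Proof.
rewrite /fusion_coef (dim_hom_sym abC ssC).
exact: dim_hom_adjoint (dualP X) _ _.
Qed.

Lemma fusion_coef_unit A B : fusion_coef unit_ A B = \dim {: hom B A}.
Proof.
apply: isomorphic_dim_homr.
by exists (lunit A), (lunitV A); apply: lunitK.
Qed.

Lemma tens_assoc_iso X Y Z : isomorphic ((X \ox Y) \ox Z) (X \ox (Y \ox Z)).
Proof. by exists (assoc X Y Z), (assocV X Y Z); apply: assocK. Qed.

End FusionCoefficients.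

Section Subcategory.
Context {K : closedFieldType} {C : fusionCategory K}.
Variable D : set C.
Hypothesis fsubD : fusion_subcategory D.
Implicit Types X Y Z A B S : C.

Let abC := fus_abelian C.
Let ssC := @fus_semisimple _ C.

Lemma fsub_iso X Y : isomorphic X Y -> D X -> D Y.
Proof.
move=> /isomorphic_sym/isomorphic_direct_sum sY DX.
exact: (fsub_sum fsubD sY).
Qed.

Lemma fsub_simple_summand X S :
  D X -> simple S -> (0 < \dim {: hom S X})%N -> D S.
Proof.
move=> DX sS; have [n [s [ss Xs]]] := ssC X.
rewrite (dim_hom_sumr _ Xs) lt0n sum_nat_eq0 negb_forall => /existsP[k].
rewrite implyTb => nz; have [Ssk|nSsk] := pselect (isomorphic S (s k)).
  exact: fsub_iso (isomorphic_sym Ssk) (fsub_summand fsubD Xs DX k).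
by rewrite (dim_hom_not_iso abC sS (ss k) nSsk) in nz.
Qed.

Lemma finite_simple_classes : finite_set (simple_classes D).
Proof.
apply: sub_finite_set (fus_finite C) => _ [X [sX _] <-].
by exists X.
Qed.

Lemma irr_spec (i : 'I_(rank D)) :
  [/\ simple (irr i), D (irr i) &
      iso_class (irr i) = nth set0 (fset_set (simple_classes D)) i].
Proof.
have : nth set0 (fset_set (simple_classes D)) i \in fset_set (simple_classes D).
  exact: mem_nth.
rewrite in_fset_set ?in_setE; last exact: finite_simple_classes.
rewrite /irr; set N := nth _ _ _ => -[X [sX DX] XN].
have NX : N X by rewrite -XN; apply: isomorphic_refl.
have Xi : isomorphic X (xget (unit_ : {classic C}) N).
  move: (@xgetPex _ (unit_ : {classic C}) N (ex_intro _ X NX)).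
  by rewrite -{1}XN.
split; first exact: isomorphic_simple Xi sX.
  exact: fsub_iso Xi DX.
by apply: etrans XN; apply/iso_classP; apply: isomorphic_sym.
Qed.

Lemma simple_irr (i : 'I_(rank D)) : simple (irr i).
Proof. by have [] := irr_spec i. Qed.

Lemma fsub_irr (i : 'I_(rank D)) : D (irr i).
Proof. by have [] := irr_spec i. Qed.

Lemma irr_inj (i j : 'I_(rank D)) : isomorphic (irr i) (irr j) -> i = j.
Proof.
have [_ _ iE] := irr_spec i; have [_ _ jE] := irr_spec j.
move=> /iso_classP; rewrite iE jE => /eqP.
rewrite nth_uniq ?fset_uniq //; first by move/eqP/val_inj.
Qed.

Lemma irr_exists S : simple S -> D S -> exists i, isomorphic S (irr (D := D) i).
Proof.
move=> sS DS.
have clS : iso_class S \in fset_set (simple_classes D).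
  by rewrite in_fset_set ?in_setE; [exists S | apply: finite_simple_classes].
exists (Ordinal (n := rank D) (m := index (iso_class S) (fset_set
  (simple_classes D)))
  (etrans (index_mem _ _) clS)).
apply/iso_classP.
by have [_ _ ->] := irr_spec (Ordinal (etrans (index_mem _ _) clS)); rewrite
  nth_index.
Qed.

Lemma fsub_expand (V : nmodType) (phi : C -> V) X :
  additive_on_sums phi -> D X ->
  phi X = \sum_(i < rank D) phi (irr i) *+ \dim {: hom (irr i) X}.
Proof.
move=> add DX; apply: additive_expand => //.
- exact: simple_irr.
- exact: irr_inj.
- move=> S sS SX; apply: irr_exists => //.
  exact: fsub_simple_summand DX sS SX.
Qed.

End Subcategory.

Lemma fusion_subcategoryT (K : fieldType) (C : fusionCategory K) :
  fusion_subcategory [set: C].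
Proof. by []. Qed.

Section Complement.
Context {K : closedFieldType} {C : fusionCategory K}.
Variables (D : set C) (rho : bool -> C).
Hypothesis fsubD : fusion_subcategory D.
Hypothesis rho_simple : forall b, simple (rho b).
Hypothesis rho_inj : forall b b', isomorphic (rho b) (rho b') -> b = b'.
Hypothesis rho_notin : forall b, ~ D (rho b).
Hypothesis rho_exists :
  forall S, simple S -> ~ D S -> exists b, isomorphic S (rho b).

Lemma complement_expand (V : nmodType) (phi : C -> V) Y b :
  additive_on_sums phi -> D Y ->
  phi (Y \ox rho b) =
  \sum_b' phi (rho b') *+ fusion_coef Y (rho b) (rho b').
Proof.
move=> add DY; apply: (additive_expand (fus_abelian C) (@fus_semisimple _ C))
  => //.
move=> S sS SY; apply: rho_exists => // DS; case: (@rho_notin b).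
apply: (fsub_simple_summand fsubD (X := dual Y \ox S)) => //.
  by apply: (fsub_tens fsubD) => //; apply: (fsub_dual fsubD).
by rewrite -/(fusion_coef _ _ _) fusion_coef_dual.
Qed.

End Complement.

(** * Frobenius-Perron dimensions *)

(* Only the easy half of Perron-Frobenius: a positive eigenvector is given. *)
Lemma sup_eigenvalue (R : realType) n (M : 'M[R]_n) (u : 'I_n -> R) (l : R) :
  (0 < n)%N ->
  (forall i j, 0 <= M i j) ->
  (forall i, 0 < u i) ->
  (forall j, \sum_i u i * M i j = l * u j) ->
  sup [set a : R | 0 <= a /\ eigenvalue M a] = l.
Proof.
move=> n_gt0 M0 u0 uM; pose i0 := Ordinal n_gt0.
have l0 : 0 <= l.
  rewrite -(pmulr_lge0 _ (u0 i0)) -uM; apply: sumr_ge0 => i _.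
  by rewrite mulr_ge0 // ltW.
set A := [set _ | _].
have Al : A l.
  split=> //; apply/eigenvalueP; exists (\row_i u i).
    apply/rowP => j; rewrite !mxE -uM; apply: eq_bigr => i _.
    by rewrite mxE.
  apply/eqP => /rowP/(_ i0); rewrite !mxE => ui0.
  by have := u0 i0; rewrite ui0 ltxx.
have ubA : ubound A l.
  move=> b [b0 /eigenvalueP[v vM nzv]].
  have [i _ maxi] := @Order.TotalTheory.arg_maxP _ _ _ i0 xpredT
    (fun i => `|v 0 i| / u i) isT.
  pose t := `|v 0 i| / u i.
  have vt k : `|v 0 k| <= t * u k by rewrite -ler_pdivrMr //; apply: maxi.
  have t_gt0 : 0 < t.
    have [j nzj] : exists j, v 0 j != 0 by apply/rV0Pn.
    rewrite -(pmulr_lgt0 _ (u0 j)); apply: lt_le_trans (vt j).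
    by rewrite normr_gt0.
  have tui : t * u i = `|v 0 i| by rewrite divfK // gt_eqF.
  suff : b * (t * u i) <= l * (t * u i).
    by rewrite ler_pM2r //; exact: mulr_gt0.
  rewrite [in leLHS]tui -[b](ger0_norm b0) -normrM.
  have /rowP/(_ i) := vM; rewrite !mxE => <-.
  apply: le_trans (ler_norm_sum _ _ _) _.
  rewrite mulrCA -uM mulr_sumr; apply: ler_sum => k _.
  by rewrite normrM (ger0_norm (M0 _ _)) mulrA ler_wpM2r.
apply/eqP; rewrite eq_le ge_sup //=; last by exists l.
by rewrite ub_le_sup //; exists l.
Qed.

Section FrobeniusPerron.
Context {R : realType} {K : closedFieldType} {C : fusionCategory K}.
Variables (D : set C) (rho : bool -> C).
Hypothesis fsubD : fusion_subcategory D.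
Hypothesis rho_simple : forall b, simple (rho b).
Hypothesis rho_inj : forall b b', isomorphic (rho b) (rho b') -> b = b'.
Hypothesis rho_notin : forall b, ~ D (rho b).
Hypothesis rho_exists :
  forall S, simple S -> ~ D S -> exists b, isomorphic S (rho b).

Let N Y i j : nat := fusion_coef Y (rho i) (rho j).

Variable w : R.
Hypothesis w_gt0 : 0 < w.
Hypothesis w_eigen : forall Y, D Y ->
  ((N Y true true)%:R + (N Y true false)%:R * w) * w =
  (N Y false true)%:R + (N Y false false)%:R * w.

Let g Y : R := (N Y true true)%:R + (N Y true false)%:R * w.

Let g_add : additive_on_sums g.
Proof.
move=> X n s Xs; rewrite /g big_split /= -mulr_suml -!natr_sum.
by rewrite -!(additive_tensl (rho true) (additive_dim_hom _) Xs).
Qed.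

Let g_ge0 Y : 0 <= g Y.
Proof. by rewrite addr_ge0 ?mulr_ge0 // ltW. Qed.

Let g_unit : g unit_ = 1.
Proof.
rewrite /g /N !fusion_coef_unit (dim_hom_iso (fus_abelian C)) //; last first.
  exact: isomorphic_refl.
rewrite (dim_hom_not_iso (fus_abelian C)) ?mul0r ?addr0 //.
by move/rho_inj.
Qed.

Let N_tens Y Z j : D Z -> N (Y \ox Z) true j =
  (N Y true j * N Z true true + N Y false j * N Z true false)%N.
Proof.
move=> DZ; rewrite /N {1}/fusion_coef.
rewrite (isomorphic_dim_homr _ (tens_assoc_iso _ _ _)).
have mulrnE m n : m *+ n = (m * n)%N by rewrite -mulr_natr natn.
have := complement_expand fsubD rho_simple rho_inj rho_notin rho_exists true
  (additive_tensr Y (additive_dim_hom (rho j))) DZ.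
by move=> ->; rewrite big_bool !mulrnE.
Qed.

Let g_tens Y Z : D Y -> D Z -> g (Y \ox Z) = g Y * g Z.
Proof.
move=> DY DZ; have := w_eigen DY; rewrite /g !N_tens // !natrD !natrM.
set a := (N Y true true)%:R; set b := (N Y true false)%:R.
set c := (N Y false true)%:R; set d := (N Y false false)%:R => E.
set p := (N Z true true)%:R; set q := (N Z true false)%:R.
transitivity ((a + b * w) * p + (c + d * w) * q); first by ring.
by rewrite -E; ring.
Qed.

Let g_irr_gt0 (j : 'I_(rank D)) : 0 < g (irr j).
Proof.
have Dj := fsub_irr fsubD j; have Ddj := fsub_dual fsubD Dj.
have [i0 unit_i0] := irr_exists fsubD (fus_unit C) (fsub_unit fsubD).
have : 1 <= g (dual (irr j)) * g (irr j).
  rewrite -g_tens // (fsub_expand fsubD g_add (fsub_tens fsubD Ddj Dj)).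
  rewrite (bigD1 i0) //= -[1]addr0 lerD ?sumr_ge0 // => [|i _]; last first.
    by rewrite mulrn_wge0.
  rewrite -(additive_isomorphic g_add unit_i0) g_unit ler1n.
  rewrite -(isomorphic_dim_homl _ unit_i0) -/(fusion_coef _ _ _)
    fusion_coef_dual.
  have <- : \dim {: hom (irr j) (irr j)} = fusion_coef (irr j) unit_ (irr j).
    apply: isomorphic_dim_homr; apply: isomorphic_sym.
    by exists (runit (irr j)), (runitV (irr j)); apply: runitK.
  apply/dim_hom_gt0; exists (idm (irr j)).
  by have [/eqP] := simple_irr fsubD j.
rewrite lt_neqAle g_ge0 andbT; apply: contraTneq => <-.
by rewrite mulr0 ler10.
Qed.

Lemma FPdim_complement Y : D Y -> FPdim R D Y = g Y.
Proof.
move=> DY; rewrite /FPdim (fsub_expand fsubD g_add DY); apply: eq_bigr => k _.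
rewrite -[RHS]mulr_natl; congr (_ * _).
have [i0 _] := irr_exists fsubD (fus_unit C) (fsub_unit fsubD).
have Dk := fsub_irr fsubD k.
apply: (sup_eigenvalue (u := fun i => g (irr i))) => //.
- exact: leq_ltn_trans (ltn_ord i0).
- by move=> i j; rewrite mxE.
- move=> j; have Dj := fsub_irr fsubD j.
  rewrite -g_tens // (fsub_expand fsubD g_add (fsub_tens fsubD Dk Dj)).
  by apply: eq_bigr => i _; rewrite mxE mulr_natr.
Qed.

End FrobeniusPerron.

(** * Quadratic integers *)

Lemma integral_cat_dim (K : closedFieldType) (C : fusionCategory K)
    (a : spherical_structure C) (X : C) :
  integralOver (intr : int -> K) (cat_dim a X).
Proof.
have fsubT := fusion_subcategoryT C.
have [X0|nzX] := eqVneq (cat_dim a X) 0.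
  exists 'X; first exact: monicX.
  by rewrite map_polyX X0 rootX.
pose M : 'M[int]_(rank [set: C]) :=
  \matrix_(i, j) (fusion_coef X (irr j) (irr i))%:R.
exists (char_poly M); first exact: char_poly_monic.
rewrite map_char_poly -eigenvalue_root_char.
apply/eigenvalueP; exists (\row_i cat_dim a (irr i)).
  apply/rowP => j; rewrite !mxE -cat_dim_tens.
  rewrite (fsub_expand fsubT (@cat_dim_sum _ _ a) (X := X \ox _)) //.
  by apply: eq_bigr => i _; rewrite !mxE rmorph_nat mulr_natr.
apply: contra_neq nzX => /rowP u0.
rewrite (fsub_expand fsubT (@cat_dim_sum _ _ a) (X := X)) //.
by apply: big1 => i _; have := u0 i; rewrite !mxE => ->; rewrite mul0rn.
Qed.

(* Conjugating the equation shows that [y / x] is its own conjugate. *)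
Lemma symmetric_ratio_real (R : rcfType) (x y b d : R[i]) :
  b != 0 -> b \is Num.real -> d \is Num.real -> (x != 0) || (y != 0) ->
  b * (x ^+ 2 - y ^+ 2) = d * x * y ->
  x != 0 /\ exists2 r : R, r != 0 & y = r%:C%C * x.
Proof.
move=> nzb /CrealP bR /CrealP dR nzxy E.
have nzx : x != 0.
  apply: contraTneq nzxy => x0; move/eqP: E.
  rewrite x0 mulr0 mul0r expr0n /= add0r mulf_eq0 (negPf nzb) oppr_eq0 expf_eq0
    /=.
  by move=> /eqP ->; rewrite eqxx.
have nzy : y != 0.
  apply: contraTneq nzxy => y0; move/eqP: E.
  rewrite y0 mulr0 expr0n /= subr0 mulf_eq0 (negPf nzb) expf_eq0 /=.
  by move=> /eqP ->; rewrite eqxx.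
split=> //; have [z yE] : exists z, y = z * x by exists (y / x); rewrite divfK.
have Ez : b * (1 - z ^+ 2) = d * z.
  apply: (mulIf (expf_neq0 2 nzx)); move: E; rewrite yE => E.
  transitivity (b * (x ^+ 2 - (z * x) ^+ 2)); first by ring.
  by rewrite E; ring.
have Ez' : b * (1 - z^* ^+ 2) = d * z^*.
  by have := congr1 Num.conj Ez; rewrite !rmorphM rmorphB rmorph1 rmorphXn /=
    bR dR.
have : b * ((z^* - z) * (1 + z * z^*)) = 0.
  transitivity (b * (1 - z ^+ 2) * z^* - b * (1 - z^* ^+ 2) * z); first by ring.
  by rewrite Ez Ez'; ring.
have nz1 : 1 + z * z^* != 0.
  by rewrite gt_eqF // ltr_wpDr // mul_conjC_ge0.
move/eqP; rewrite !mulf_eq0 (negPf nzb) (negPf nz1) orbF subr_eq0 => /= zR.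
have zreal : z \is Num.real by apply/CrealP/eqP.
exists (complex.Re z); last by rewrite RRe_real.
apply: contra_neq nzy => z0; rewrite yE -(RRe_real zreal) z0 /=.
by rewrite mul0r.
Qed.

Section Main.
Context {R : realType} {C : fusionCategory R[i]}.
Variables (a : spherical_structure C) (D : set C) (rho : bool -> C).
Hypothesis fsubD : fusion_subcategory D.
Hypothesis intD : integral_subcategory R D.
Hypothesis rho_simple : forall b, simple (rho b).
Hypothesis rho_inj : forall b b', isomorphic (rho b) (rho b') -> b = b'.
Hypothesis rho_notin : forall b, ~ D (rho b).
Hypothesis rho_exists :
  forall S, simple S -> ~ D S -> exists b, isomorphic S (rho b).

Let N Y i j : nat := fusion_coef Y (rho i) (rho j).
Let x := cat_dim a (rho true).
Let y := cat_dim a (rho false).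

Let dim_tens_rho Y b : D Y -> cat_dim a Y * cat_dim a (rho b) =
  (N Y b true)%:R * x + (N Y b false)%:R * y.
Proof.
move=> DY; rewrite -cat_dim_tens.
have := complement_expand fsubD rho_simple rho_inj rho_notin rho_exists b
  (@cat_dim_sum _ _ a) DY.
by move=> ->; rewrite big_bool /= -[x *+ _]mulr_natl -[y *+ _]mulr_natl.
Qed.

Let dims_eq Y : D Y ->
  (N Y true true)%:R * x * y + (N Y true false)%:R * y ^+ 2 =
  (N Y false true)%:R * x ^+ 2 + (N Y false false)%:R * x * y.
Proof.
move=> DY; have E1 := dim_tens_rho true DY; have E2 := dim_tens_rho false DY.
transitivity (((N Y true true)%:R * x + (N Y true false)%:R * y) * y).
  by ring.
rewrite -E1; transitivity (cat_dim a Y * y * x); first by rewrite mulrAC.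
by rewrite E2; ring.
Qed.

Let N_dual Y i j : N (dual Y) i j = N Y j i.
Proof. exact: fusion_coef_dual. Qed.

(* Either [(1, r)] or the vector [(- r, 1)] orthogonal to it is positive; the
   latter is a joint eigenvector because the action of the dual object is the
   transposed one. *)
Let rational_ratio (X : C) : D X -> (N X true false + N X false true != 0)%N ->
  (x != 0) || (y != 0) ->
  x != 0 /\ exists2 q : rat, q != 0 & y = ratr q * x.
Proof.
move=> DX nzX nzxy; have DdX := fsub_dual fsubD DX.
pose b : R[i] := (N X true false + N X false true)%:R.
pose d : R[i] := 2 * (N X true true)%:R - 2 * (N X false false)%:R.
have [||||nzx [r nzr yE]] := @symmetric_ratio_real R x y b d _ _ _ nzxy.
- by rewrite pnatr_eq0.
- exact: realn.
- by rewrite rpredB // rpredM // realn.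
- have := dims_eq DX; have := dims_eq DdX; rewrite !N_dual /b /d natrD.
  set A := (N X true true)%:R; set B := (N X true false)%:R.
  set B' := (N X false true)%:R; set A' := (N X false false)%:R => E1 E2.
  apply/eqP; rewrite -subr_eq0; apply/eqP.
  transitivity ((B * x ^+ 2 + A' * x * y - (A * x * y + B' * y ^+ 2)) +
                (B' * x ^+ 2 + A' * x * y - (A * x * y + B * y ^+ 2))).
    by ring.
  by rewrite E1 E2 !subrr addr0.
split=> //.
have r_eigen Y : D Y -> ((N Y true true)%:R + (N Y true false)%:R * r) * r =
    (N Y false true)%:R + (N Y false false)%:R * r.
  move=> DY; have := dims_eq DY; rewrite yE => E.
  apply: (@complexI R); apply: (mulIf (expf_neq0 2 nzx)).
  rewrite !(rmorphD, rmorphM, rmorph_nat) /=.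
  have -> : forall m n : R[i], (m + n * r%:C%C) * r%:C%C * x ^+ 2 =
      m * x * (r%:C%C * x) + n * (r%:C%C * x) ^+ 2.
    by move=> m n; ring.
  by rewrite E; ring.
have [w [w_gt0 w_eigen wr]] : exists w : R, [/\ 0 < w,
    forall Y, D Y -> ((N Y true true)%:R + (N Y true false)%:R * w) * w =
                     (N Y false true)%:R + (N Y false false)%:R * w &
    w = r \/ w = - r^-1].
  have [r_gt0|r_le0] := ltP 0 r; first by exists r; split=> //; left.
  exists (- r^-1); split; last by right.
    by rewrite oppr_gt0 invr_lt0 lt_neqAle nzr.
  move=> Y DY; have := r_eigen _ (fsub_dual fsubD DY); rewrite !N_dual => E.
  apply: (mulIf (expf_neq0 2 nzr)); move: E.
  set A := (N Y true true)%:R; set B := (N Y true false)%:R.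
  set B' := (N Y false true)%:R; set A' := (N Y false false)%:R => E.
  transitivity (B - A * r); first by field.
  transitivity (B' * r ^+ 2 - A' * r); last by field.
  by rewrite -[B](addrK (A' * r)) -E; ring.
pose g Y := (N Y true true)%:R + (N Y true false)%:R * w.
have g_int Y : D Y -> g Y \is a Num.int.
  move=> DY.
  by rewrite /g -(FPdim_complement fsubD rho_simple rho_inj rho_notin rho_exists
       w_gt0 w_eigen DY) intD.
have [q wE] : exists q : rat, w = ratr q.
  have /intrP[m mE] : g X + g (dual X) \is a Num.int by rewrite rpredD ?g_int.
  exists ((m%:~R - 2 * (N X true true)%:R) / (N X true false + N X false
    true)%:R).
  have nzb : (N X true false + N X false true)%:R != 0 :> R by rewrite
    pnatr_eq0.
  rewrite fmorph_div rmorphB rmorphM /= !rmorph_nat ratr_int -mE /g !N_dual.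
  apply: (mulIf nzb); rewrite divfK // natrD; ring.
have nzq : q != 0.
  by apply: contraTneq w_gt0 => q0; rewrite wE q0 rmorph0 ltxx.
case: wr => wr.
  by exists q => //; rewrite yE -wr wE fmorph_rat.
exists (- q^-1); first by rewrite oppr_eq0 invr_eq0.
by rewrite yE -[r]invrK -[r^-1]opprK -wr wE invrN rmorphN fmorphV fmorph_rat
  -fmorphV -rmorphN.
Qed.

Let fsub_dim_rational q Y : x != 0 -> y = ratr q * x -> D Y ->
  exists p : rat, cat_dim a Y = ratr p.
Proof.
move=> nzx yE DY.
exists ((N Y true true)%:R + (N Y true false)%:R * q).
apply: (mulIf nzx); rewrite dim_tens_rho // yE rmorphD rmorphM /= !rmorph_nat.
by rewrite mulrDl mulrA.
Qed.

Let dim_span q Z : x != 0 -> y = ratr q * x ->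
  exists p s : rat, cat_dim a Z = ratr p + ratr s * x.
Proof.
move=> nzx yE; have fsubT := fusion_subcategoryT C.
have irr_span (i : 'I_(rank [set: C])) :
    exists ps : rat * rat, cat_dim a (irr i) = ratr ps.1 + ratr ps.2 * x.
  have [Di|nDi] := pselect (D (irr i)).
    have [p ->] := fsub_dim_rational nzx yE Di.
    by exists (p, 0); rewrite /= rmorph0 mul0r addr0.
  have [b ib] := rho_exists (simple_irr fsubT i) nDi.
  rewrite (additive_isomorphic (@cat_dim_sum _ _ a) ib).
  case: b {ib}; first by exists (0, 1); rewrite /= rmorph0 rmorph1 add0r mul1r.
  by exists (0, q); rewrite /= rmorph0 add0r.
have [ps psE] := choice irr_span.
rewrite (fsub_expand fsubT (@cat_dim_sum _ _ a) (X := Z)) //.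
exists (\sum_i (ps i).1 *+ \dim {: hom (irr i) Z}).
exists (\sum_i (ps i).2 *+ \dim {: hom (irr i) Z}).
rewrite !rmorph_sum mulr_suml -big_split /=; apply: eq_bigr => i _.
by rewrite psE !rmorphMn mulrnDl mulrnAl.
Qed.

Let quadratic_cat_dim Z (p s : rat) :
  cat_dim a Z ^+ 2 = ratr p + ratr s * cat_dim a Z ->
  quadratic_integer (cat_dim a Z).
Proof.
move=> ZE; split; first exact: integral_cat_dim.
exists (Poly [:: - p; - s; 1]); split.
- by apply/eqP => /polyP/(_ 2%N); rewrite coef_Poly coef0 /= => /eqP; rewrite
  oner_eq0.
- exact: size_Poly.
- rewrite map_Poly_id0 ?rmorph0 // /root horner_Poly /= !rmorphN rmorph1.
  apply/eqP; transitivity (cat_dim a Z ^+ 2 - (ratr p + ratr s * cat_dim a Z)).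
    by ring.
  by rewrite ZE subrr.
Qed.

Lemma quadratic_dim_complement (X : C) :
  D X -> (N X true false + N X false true != 0)%N ->
  forall b, quadratic_integer (cat_dim a (rho b)).
Proof.
move=> DX nzX.
have [|nzxy] := boolP ((x == 0) && (y == 0)).
  move=> /andP[/eqP x0 /eqP y0] b.
  apply: (@quadratic_cat_dim (rho b) 0 0).
  have -> : cat_dim a (rho b) = 0 by case: b.
  by rewrite expr2 !mulr0 rmorph0 addr0.
rewrite negb_and in nzxy.
have [nzx [q nzq yE]] := rational_ratio DX nzX nzxy.
have [p [s]] := dim_span (rho true \ox rho true) nzx yE.
rewrite cat_dim_tens -expr2 => xE [].
  exact: quadratic_cat_dim xE.
apply: (@quadratic_cat_dim (rho false) (q ^+ 2 * p) (q * s)).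
rewrite -/y yE exprMn xE !rmorphM /=.
by ring.
Qed.

End Main.

Theorem lemma5p2 (R : realType) (C : fusionCategory R[i])
    (a : spherical_structure C) (D : set C) (rho1 rho2 : C) :
  fusion_subcategory D ->
  integral_subcategory R D ->
  (rank D + 2)%N = rank [set: C] ->
  simple_classes [set: C] `\` simple_classes D =
    [set iso_class rho1; iso_class rho2] ->
  (exists X : C, [/\ simple X, D X &
     (fusion_coef X rho1 rho2 != 0 \/ fusion_coef X rho2 rho1 != 0)%N]) ->
  quadratic_integer (cat_dim a rho1) /\ quadratic_integer (cat_dim a rho2).
Proof.
move=> fsubD intD rankD diffD [X [_ DX nzX]].
pose rho b := if b then rho1 else rho2.
have rho_diff b :
    (simple_classes [set: C] `\` simple_classes D) (iso_class (rho b)).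
  by rewrite diffD; case: b; [left|right].
have rho_simple b : simple (rho b).
  have [[S [sS _] /iso_classP SE] _] := rho_diff b.
  exact: isomorphic_simple SE sS.
have rho_notin b : ~ D (rho b).
  by move=> Db; have [_ []] := rho_diff b; exists (rho b).
have rho_exists S : simple S -> ~ D S -> exists b, isomorphic S (rho b).
  move=> sS nDS.
  have : (simple_classes [set: C] `\` simple_classes D) (iso_class S).
    split; first by exists S.
    by case=> T [_ DT] /iso_classP TS; apply: nDS; apply: fsub_iso TS DT.
  by rewrite diffD => -[] /iso_classP; [exists true|exists false].
have not12 : ~ isomorphic rho1 rho2.
  move=> /iso_classP E12; move: diffD; rewrite E12 setUid => diffD.
  have finT := finite_simple_classes [set: C].
  have finD := finite_simple_classes D.
  have := fset_setD finT finD; rewrite diffD fset_set1.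
  move=> /(congr1 (fun A : {fset _} => #|` A|%fset)); rewrite cardfs1 cardfsD.
  have := fsubset_leq_card (fsubsetIr (fset_set (simple_classes [set: C]))
    (fset_set (simple_classes D))).
  by move: rankD; rewrite /rank => <-; clear; set u := #|`_|; lia.
have rho_inj b b' : isomorphic (rho b) (rho b') -> b = b'.
  by case: b b' => -[] //; last move/isomorphic_sym.
have nzN : (fusion_coef X (rho true) (rho false) +
            fusion_coef X (rho false) (rho true) != 0)%N.
  by rewrite addn_eq0 negb_and; apply/orP.
have quad := quadratic_dim_complement a fsubD intD rho_simple rho_inj rho_notin
  rho_exists DX nzN.
by split; [apply: (quad true)|apply: (quad false)].
Qed.
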